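(* Let $f\in\mathrm{Diff}^{\infty}_0([0,1])$ be different from the identity map, and let $E(f)=E_\infty(f)=\{0,1\}$. Assume that $\varphi(x)=f(x)-x>0$ for $x\in(0,1)$. Suppose that for every $\varepsilon>0$ there exists $C_\varepsilon>0$ such that $$\varphi(y)\le C_\varepsilon(\varphi(x))^{1-\varepsilon},\qquad 0<y<x<\tfrac12,$$ and the same inequality $\varphi(y)\le C_\varepsilon(\varphi(x))^{1-\varepsilon}$ holds for $\tfrac12<x<y<1$. Then $$\limsup_{n\to\infty}\frac{\log\Gamma_n(f)}{\log n}=1.$$
   Context: $\mathrm{Diff}^{\infty}_0([0,1])$ is the group of all $C^\infty$-smooth diffeomorphisms of $[0,1]$ onto itself fixing the endpoints $0$ and $1$. With $f^n$ the $n$-th iterate of $f$ and $f^{-n}$ the $n$-th iterate of $f^{-1}$, the growth sequence of $f$ is $$\Gamma_n(f)=\max\bigl(\max_{x\in[0,1]}|(f^n)'(x)|,\ \max_{x\in[0,1]}|(f^{-n})'(x)|\bigr),\qquad n\ge1.$$ $E(f)=\{x\in[0,1]:f(x)=x\}$ is the set of fixed points of $f$, and $E_\infty(f)=\{x\in E(f): f'(x)=1,\ f^{(j)}(x)=0\text{ for all }j\ge2\}$. *)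

(* Defs.v *)
From Stdlib Require Import Reals.
From Coquelicot Require Import Coquelicot.
Open Scope R_scope.

Definition I01 (x : R) : Prop := 0 <= x <= 1.

(* A function on [0,1] is represented by some g : R -> R; its values outside
   [0,1] are irrelevant to every definition below. *)

(* Derivative at x of the restriction of g to [0,1]: the limit of the
   difference quotient at y -> x with y in [0,1], hence one-sided at the
   endpoints. [iota] picks the unique l satisfying the predicate; the value is
   meaningless where no such limit exists. *)
Definition deriv01 (g : R -> R) (x : R) : R :=
  iota (fun l : R => D_in g (fun _ => l) I01 x).

Definition derivn01 (j : nat) (g : R -> R) : R -> R := Nat.iter j deriv01 g.

Definition smooth01 (g : R -> R) : Prop :=
  forall (j : nat) (x : R), I01 x ->
    D_in (derivn01 j g) (derivn01 (S j) g) I01 x.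

Record Diff01 : Type := mkDiff01 {
  dfun :> R -> R;
  dinv : R -> R;
  dfun_maps : forall x, I01 x -> I01 (dfun x);
  dinv_maps : forall x, I01 x -> I01 (dinv x);
  dinv_dfun : forall x, I01 x -> dinv (dfun x) = x;
  dfun_dinv : forall x, I01 x -> dfun (dinv x) = x;
  dfun_smooth : smooth01 dfun;
  dinv_smooth : smooth01 dinv;
  dfun_0 : dfun 0 = 0;
  dfun_1 : dfun 1 = 1
}.

Definition is_max01 (g : R -> R) (m : R) : Prop :=
  (exists x, I01 x /\ g x = m) /\ (forall x, I01 x -> g x <= m).

Definition max01 (g : R -> R) : R := iota (is_max01 g).

Definition growth (f : Diff01) (n : nat) : R :=
  Rmax (max01 (fun x => Rabs (deriv01 (Nat.iter n (dfun f)) x)))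
       (max01 (fun x => Rabs (deriv01 (Nat.iter n (dinv f)) x))).

Definition fixed_points (f : Diff01) (x : R) : Prop := I01 x /\ f x = x.

Definition flat_fixed_points (f : Diff01) (x : R) : Prop :=
  fixed_points f x /\ deriv01 f x = 1 /\
  (forall j : nat, (2 <= j)%nat -> derivn01 j f x = 0).

Definition displacement (f : Diff01) (x : R) : R := f x - x.

(* Main.v *)
Require Import Defs.
From Stdlib Require Import Reals Lra Lia.
From Coquelicot Require Import Coquelicot.
Open Scope R_scope.

(* Along an orbit x_k = f^k(x), the mean value theorem gives phi(x_(k+1)) = f'(t) phi(x_k)
   with t in [x_k, x_(k+1)], and the phi(x_k) sum to at most 1; hence (f^n)'(x) equals
   phi(x_n) / phi(x) up to a constant factor.

   Lower bound: since the phi(x_n) are summable, phi(x_n) <= 1/n infinitely often, and then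
   the derivative of f^(-n) at x_n is at least c n.

   Upper bound: interpolating between phi and its high derivatives, which vanish at the
   endpoints, the almost monotonicity of phi yields |phi'| <= C phi^s for every s < 1.
   Therefore u_k = phi(x_k) satisfies u_(k+1) <= u_k (1 + C u_k^s): either u_n <= 2 u_0, or
   u_0 >= c n^(-1/s); in both cases u_n / u_0 is at most of order n^(1/s). The same holds
   backwards along the orbit. *)

(** * One-sided differentiation on [0,1] *)

Definition has_deriv01 (g dg : R -> R) : Prop :=
  forall x, I01 x -> D_in g dg I01 x.

(** Limits along [I01] are unique only at accumulation points; this makes the [iota] in [deriv01]
    pick a determined value, endpoints included. *)
Lemma I01_accumulation (x : R) : I01 x -> adhDa (D_x I01 x) x.
Proof.
  intros Hx alp Halp. unfold I01 in Hx.
  set (h := Rmin alp (1 / 2) / 2).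
  assert (Hh : 0 < h /\ h < alp /\ h <= 1 / 4).
  { unfold h, Rmin; destruct (Rle_dec alp (1 / 2)); lra. }
  destruct (Rle_dec x (1 / 2)).
  - exists (x + h). unfold D_x, I01, Rdist.
    split; [split; lra|]. apply Rabs_def1; lra.
  - exists (x - h). unfold D_x, I01, Rdist.
    split; [split; lra|]. apply Rabs_def1; lra.
Qed.

Lemma deriv01_unique (g dg : R -> R) (x : R) :
  I01 x -> D_in g dg I01 x -> deriv01 g x = dg x.
Proof.
  intros Hx Hd. unfold deriv01.
  apply (@iota_unique _ R_CompleteNormedModule (fun l : R => D_in g (fun _ => l) I01 x)).
  - intros y Hy. exact (single_limit _ _ _ _ _ (I01_accumulation x Hx) Hy Hd).
  - exact Hd.
Qed.

Lemma D_in_deriv01 (g dg : R -> R) (x : R) :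
  I01 x -> D_in g dg I01 x -> D_in g (deriv01 g) I01 x.
Proof.
  intros Hx Hd. unfold D_in. rewrite (deriv01_unique g dg x Hx Hd). exact Hd.
Qed.

Lemma D_in_ext_on (g h dg : R -> R) (D : R -> Prop) (x : R) :
  (forall t, D t -> g t = h t) -> D x -> D_in g dg D x -> D_in h dg D x.
Proof.
  intros E Dx H eps Heps. destruct (H eps Heps) as [alp [Halp K]].
  exists alp; split; [exact Halp|].
  intros t [[Dt Nt] Ht]. rewrite <- !E by assumption. apply K. repeat split; assumption.
Qed.

Lemma D_in_comp01 (g h dg dh : R -> R) (x : R) :
  (forall t, I01 t -> I01 (g t)) -> I01 x -> D_in g dg I01 x -> D_in h dh I01 (g x) ->
  D_in (fun t => h (g t)) (fun t => dg t * dh (g t)) I01 x.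
Proof.
  intros Hm Hx Dg Dh eps Heps.
  destruct (Dcomp _ _ _ _ _ _ x Dg Dh eps Heps) as [alp [Halp K]].
  exists alp; split; [exact Halp|]. intros t [[It Nt] Ht]. apply K.
  split; [split; [split; [|apply Hm] |] |]; assumption.
Qed.

(** * Continuity, maxima and the mean value theorem on [0,1] *)

Definition clamp (x : R) : R := Rmax 0 (Rmin x 1).

Lemma clamp_I01 (x : R) : I01 (clamp x).
Proof.
  unfold I01, clamp, Rmax, Rmin.
  destruct (Rle_dec x 1); destruct (Rle_dec 0 _); lra.
Qed.

Lemma clamp_id (x : R) : I01 x -> clamp x = x.
Proof.
  unfold I01, clamp, Rmax, Rmin. intros Hx.
  destruct (Rle_dec x 1); destruct (Rle_dec 0 _); lra.
Qed.

Lemma clamp_contraction (x y : R) : Rabs (clamp x - clamp y) <= Rabs (x - y).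
Proof.
  unfold clamp, Rmax, Rmin, Rabs.
  repeat destruct (Rle_dec _ _); repeat destruct (Rcase_abs _); lra.
Qed.

(** The retraction [clamp] extends a function on [0,1] to the line without changing its values
    there, so that continuity on [0,1], one-sided at the endpoints, becomes ordinary continuity of
    the extension. *)
Definition continuous01 (g : R -> R) : Prop :=
  forall x, continuity_pt (fun t => g (clamp t)) x.

Lemma has_deriv01_continuous01 (g dg : R -> R) :
  has_deriv01 g dg -> continuous01 g.
Proof.
  intros H x eps Heps.
  destruct (cont_deriv _ _ _ _ (H _ (clamp_I01 x)) eps Heps) as [alp [Halp K]].
  exists alp; split; [exact Halp|]. simpl in *.
  intros t [_ Ht].
  destruct (Req_dec (clamp t) (clamp x)) as [E|N].
  - rewrite E, Rdist_eq. exact Heps.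
  - apply K. split; [split; [apply clamp_I01 | congruence]|].
    eapply Rle_lt_trans; [apply clamp_contraction | exact Ht].
Qed.

Lemma continuous01_ext (g h : R -> R) :
  (forall x, I01 x -> g x = h x) -> continuous01 g -> continuous01 h.
Proof.
  intros E H x. apply continuity_pt_ext with (fun t => g (clamp t)); [|apply H].
  intros t. apply E, clamp_I01.
Qed.

Lemma continuous01_mult (g h : R -> R) :
  continuous01 g -> continuous01 h -> continuous01 (fun x => g x * h x).
Proof.
  intros Hg Hh x. exact (continuity_pt_mult _ _ _ (Hg x) (Hh x)).
Qed.

Lemma continuous01_abs (g : R -> R) :
  continuous01 g -> continuous01 (fun x => Rabs (g x)).
Proof.
  intros Hg x. exact (continuity_pt_comp _ Rabs _ (Hg x) (Rcontinuity_abs _)).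
Qed.

Lemma continuous01_comp (g h : R -> R) :
  (forall x, I01 x -> I01 (g x)) -> continuous01 g -> continuous01 h ->
  continuous01 (fun x => h (g x)).
Proof.
  intros Hm Hg Hh x.
  apply continuity_pt_ext with (fun t => h (clamp (g (clamp t)))).
  - intros t. rewrite (clamp_id (g _)); [reflexivity | apply Hm, clamp_I01].
  - exact (continuity_pt_comp _ (fun t => h (clamp t)) _ (Hg x) (Hh _)).
Qed.

Lemma continuous01_is_max01 (g : R -> R) :
  continuous01 g -> exists m, is_max01 g m.
Proof.
  intros H.
  destruct (continuity_ab_maj (fun t => g (clamp t)) 0 1) as [M [HM IM]];
    [lra | intros c _; apply H |].
  exists (g M). split.
  - exists M. split; [exact IM | reflexivity].
  - intros x Hx. specialize (HM x Hx). now rewrite !clamp_id in HM.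
Qed.

Lemma continuous01_bounded (g : R -> R) :
  continuous01 g -> exists M, 0 < M /\ forall x, I01 x -> Rabs (g x) <= M.
Proof.
  intros H. destruct (continuous01_is_max01 _ (continuous01_abs _ H)) as [m [_ Hm]].
  exists (Rabs m + 1). split; [pose proof (Rabs_pos m); lra|].
  intros x Hx. specialize (Hm x Hx). pose proof (Rle_abs m). lra.
Qed.

(** Existence comes from compactness and uniqueness from antisymmetry, so the [iota] in [max01]
    denotes the true maximum. *)
Lemma max01_correct (g : R -> R) : continuous01 g -> is_max01 g (max01 g).
Proof.
  intros H. destruct (continuous01_is_max01 _ H) as [m Hm].
  replace (max01 g) with m; [exact Hm|]. symmetry.
  apply (@iota_unique _ R_CompleteNormedModule (is_max01 g) m); [|exact Hm].
  intros y [[z [Iz <-]] Hy]. destruct Hm as [[w [Iw <-]] Hm].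
  apply Rle_antisym; auto.
Qed.

(** Applied to the extension by [clamp], which is the identity near interior points. The endpoints
    come in either order because the flat point may lie on either side. *)
Lemma MVT01 (g dg : R -> R) (a b : R) :
  has_deriv01 g dg -> I01 a -> I01 b ->
  exists c, Rmin a b <= c <= Rmax a b /\ g b - g a = dg c * (b - a).
Proof.
  intros H Ha Hb.
  assert (Hmm : 0 <= Rmin a b /\ Rmax a b <= 1).
  { unfold I01, Rmin, Rmax in *. destruct (Rle_dec a b); lra. }
  destruct (MVT_gen (fun t => g (clamp t)) a b dg) as [c [Hc E]].
  - intros x Hx. apply is_derive_Reals. intros eps Heps.
    assert (Ix : I01 x) by (unfold I01; lra).
    destruct (H x Ix eps Heps) as [alp [Halp K]].
    assert (Hd : 0 < Rmin alp (Rmin x (1 - x))).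
    { repeat apply Rmin_glb_lt; lra. }
    exists (mkposreal _ Hd). simpl. intros h Nh Hh.
    pose proof (Rmin_l alp (Rmin x (1 - x))). pose proof (Rmin_r alp (Rmin x (1 - x))).
    pose proof (Rmin_l x (1 - x)). pose proof (Rmin_r x (1 - x)).
    assert (Ih : I01 (x + h)).
    { unfold I01. destruct (Rabs_def2 h _ Hh). lra. }
    rewrite !clamp_id by assumption.
    assert (Kh := K (x + h)). simpl in Kh. unfold Rdist in Kh.
    replace (x + h - x) with h in Kh by ring.
    apply Kh. repeat split; try apply Ih; lra.
  - intros x _. exact (has_deriv01_continuous01 _ _ H x).
  - exists c. rewrite !clamp_id in E by assumption. split; assumption.
Qed.

(** * Derivatives of iterates *)

Lemma has_deriv01_iter (g dg : R -> R) (n : nat) :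
  (forall x, I01 x -> I01 (g x)) -> has_deriv01 g dg ->
  (forall x, I01 x -> I01 (Nat.iter n g x)) /\
  has_deriv01 (Nat.iter n g) (deriv01 (Nat.iter n g)) /\
  forall x, I01 x ->
    deriv01 (Nat.iter (S n) g) x =
    dg (Nat.iter n g x) * deriv01 (Nat.iter n g) x.
Proof.
  intros Hm Hd.
  assert (Hstep : forall n : nat, (forall x, I01 x -> I01 (Nat.iter n g x)) ->
    has_deriv01 (Nat.iter n g) (deriv01 (Nat.iter n g)) ->
    forall x, I01 x -> D_in (Nat.iter (S n) g)
      (fun t => deriv01 (Nat.iter n g) t * dg (Nat.iter n g t)) I01 x).
  { intros k Ik Hk x Hx.
    exact (D_in_comp01 _ _ _ _ x Ik Hx (Hk x Hx) (Hd _ (Ik x Hx))). }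
  (* The claims share one induction: the chain rule at each step needs the iterate to stay in [0,1]
     and to be differentiable. *)
  induction n as [|n [Ik [Hk _]]].
  - assert (H0 : has_deriv01 (Nat.iter 0 g) (deriv01 (Nat.iter 0 g))).
    { intros x Hx. exact (D_in_deriv01 _ (fun _ => 1) x Hx (Dx I01 x)). }
    repeat split; trivial.
    + apply H.
    + apply H.
    + intros x Hx. rewrite Rmult_comm.
      exact (deriv01_unique _ _ _ Hx (Hstep O (fun _ I => I) H0 x Hx)).
  - assert (Ik' : forall x, I01 x -> I01 (Nat.iter (S n) g x)).
    { intros x Hx. apply Hm, Ik, Hx. }
    assert (Hk' : has_deriv01 (Nat.iter (S n) g) (deriv01 (Nat.iter (S n) g))).
    { intros x Hx. exact (D_in_deriv01 _ _ x Hx (Hstep n Ik Hk x Hx)). }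
    split; [exact Ik'|]. split; [exact Hk'|].
    intros x Hx. rewrite Rmult_comm.
    exact (deriv01_unique _ _ _ Hx (Hstep (S n) Ik' Hk' x Hx)).
Qed.

Lemma smooth01_has_deriv01 (g : R -> R) (j : nat) :
  smooth01 g -> has_deriv01 (derivn01 j g) (derivn01 (S j) g).
Proof. intros H x Hx. exact (H j x Hx). Qed.

Lemma continuous01_deriv01_iter (g : R -> R) (n : nat) :
  (forall x, I01 x -> I01 (g x)) -> smooth01 g ->
  continuous01 (deriv01 (Nat.iter n g)).
Proof.
  intros Hm Hs. pose proof (smooth01_has_deriv01 g 0 Hs) as H0.
  pose proof (has_deriv01_continuous01 _ _ (smooth01_has_deriv01 g 1 Hs)) as C1.
  induction n as [|n IH].
  - apply (continuous01_ext (fun _ => 1)).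
    + intros x Hx. symmetry. exact (deriv01_unique _ (fun _ => 1) x Hx (Dx I01 x)).
    + intros x. apply continuity_pt_const. intros u v. reflexivity.
  - destruct (has_deriv01_iter g _ n Hm H0) as [Ik [Hk E]].
    eapply continuous01_ext; [intros x Hx; symmetry; exact (E x Hx)|].
    apply continuous01_mult; [|exact IH].
    apply continuous01_comp; trivial. exact (has_deriv01_continuous01 _ _ Hk).
Qed.

(** * Interpolation for functions flat at a point *)

(** An interpolation property with exponent [a]. It quantifies over every chain [g] of successive
    derivatives flat at [e], so that it applies again to the shifted chain starting at g'; [C] is
    uniform in [x] and [B]. *)
Definition flat_power_bound (a : R) : Prop :=
  forall (g : nat -> R -> R) (e : R),
  I01 e -> (forall j, has_deriv01 (g j) (g (S j))) -> (forall j, g j e = 0) ->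
  exists C, 0 < C /\ forall x B, I01 x -> 0 < B ->
    (forall t, Rmin e x <= t <= Rmax e x -> Rabs (g O t) <= B) ->
    Rabs (g 1%nat x) <= C * Rpower B a.

Lemma flat_power_bound_0 : flat_power_bound 0.
Proof.
  intros g e _ Hd _.
  destruct (continuous01_bounded _ (has_deriv01_continuous01 _ _ (Hd 1%nat)))
    as [M [HM K]].
  exists M; split; [exact HM|]. intros x B Hx HB _.
  rewrite Rpower_O, Rmult_1_r by exact HB. exact (K x Hx).
Qed.

Lemma Rmin_Rmax_I01 (e x t : R) :
  I01 e -> I01 x -> Rmin e x <= t <= Rmax e x -> I01 t.
Proof. unfold I01, Rmin, Rmax. destruct (Rle_dec e x); lra. Qed.

Lemma Rmin_Rmax_trans (e x t u : R) :
  Rmin e x <= t <= Rmax e x -> Rmin e t <= u <= Rmax e t -> Rmin e x <= u <= Rmax e x.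
Proof. unfold Rmin, Rmax. repeat destruct (Rle_dec _ _); lra. Qed.

(* Landau's inequality, with a step of length [h] from [x] towards [e]; where this would
   overshoot [e], [g1 e = 0] makes the first term unnecessary. *)
Lemma flat_landau (g g1 g2 : R -> R) (e x B D h : R) :
  has_deriv01 g g1 -> has_deriv01 g1 g2 -> g1 e = 0 -> I01 e -> I01 x ->
  0 < h -> 0 <= B ->
  (forall t, Rmin e x <= t <= Rmax e x -> Rabs (g t) <= B) ->
  (forall t, Rmin e x <= t <= Rmax e x -> Rabs (g2 t) <= D) ->
  Rabs (g1 x) <= 2 * B / h + D * h.
Proof.
  intros H1 H2 E Ie Ix Hh HB KB KD.
  assert (HBh : 0 <= 2 * B / h).
  { apply Rmult_le_pos; [lra | apply Rlt_le, Rinv_0_lt_compat; exact Hh]. }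
  assert (HD : 0 <= D).
  { eapply Rle_trans; [apply Rabs_pos | apply (KD e)]. apply conj; [apply Rmin_l | apply Rmax_l]. }
  assert (Hnear : forall c, Rmin e x <= c <= Rmax e x -> Rabs (x - c) <= h ->
    Rabs (g1 x - g1 c) <= D * h).
  { intros c Hc Hl.
    destruct (MVT01 g1 g2 c x H2) as [u [Hu Eu]]; trivial.
    { exact (Rmin_Rmax_I01 _ _ _ Ie Ix Hc). }
    rewrite Eu, Rabs_mult. apply Rmult_le_compat; try apply Rabs_pos; trivial.
    apply KD. clear - Hc Hu. unfold Rmin, Rmax in *.
    repeat destruct (Rle_dec _ _); lra. }
  destruct (Rle_dec (Rabs (x - e)) h) as [Hle|Hgt].
  - assert (K := Hnear e (conj (Rmin_l _ _) (Rmax_l _ _)) Hle).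
    rewrite E, Rminus_0_r in K. lra.
  - assert (Hy : exists y, Rmin e x <= y <= Rmax e x /\ Rabs (x - y) = h).
    { unfold Rabs in Hgt. destruct (Rcase_abs (x - e)).
      - exists (x + h). split.
        + unfold Rmin, Rmax. destruct (Rle_dec e x); lra.
        + replace (x - (x + h)) with (- h) by ring. rewrite Rabs_Ropp. apply Rabs_pos_eq; lra.
      - exists (x - h). split.
        + unfold Rmin, Rmax. destruct (Rle_dec e x); lra.
        + replace (x - (x - h)) with h by ring. apply Rabs_pos_eq; lra. }
    destruct Hy as [y [Hy Ey]].
    destruct (MVT01 g g1 y x H1) as [c [Hc Ec]]; trivial.
    { exact (Rmin_Rmax_I01 _ _ _ Ie Ix Hy). }
    assert (Hc' : Rmin e x <= c <= Rmax e x).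
    { clear - Hc Hy. unfold Rmin, Rmax in *. repeat destruct (Rle_dec _ _); lra. }
    assert (Hxc : Rabs (x - c) <= h).
    { rewrite <- Ey. clear - Hc. unfold Rmin, Rmax, Rabs in *.
      repeat destruct (Rle_dec _ _); repeat destruct (Rcase_abs _); lra. }
    specialize (Hnear c Hc' Hxc).
    assert (Kc : Rabs (g1 c) <= 2 * B / h).
    { apply (Rmult_le_reg_r h); [exact Hh|].
      replace (2 * B / h * h) with (B + B) by (field; lra).
      rewrite <- Ey at 1. rewrite <- Rabs_mult, <- Ec.
      unfold Rminus. eapply Rle_trans; [apply Rabs_triang|]. rewrite Rabs_Ropp.
      apply Rplus_le_compat; apply KB; [|exact Hy].
      apply conj; [apply Rmin_r | apply Rmax_r]. }
    replace (g1 x) with (g1 c + (g1 x - g1 c)) by ring.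
    eapply Rle_trans; [apply Rabs_triang | lra].
Qed.

(* Applying the bound with exponent [a] to [g] and then to [g'] bounds [g''] by
   a multiple of [B^(a*a)]; Landau's inequality with [h = B^((1-a*a)/2)] does the rest. *)
Lemma flat_power_bound_step (a : R) :
  flat_power_bound a -> flat_power_bound ((1 + a * a) / 2).
Proof.
  intros H g e Ie Hd He.
  destruct (H g e Ie Hd He) as [C0 [P0 K0]].
  destruct (H (fun j => g (S j)) e Ie (fun j => Hd (S j)) (fun j => He (S j)))
    as [C1 [P1 K1]].
  set (D := C1 * Rpower C0 a).
  assert (PD : 0 < D) by (apply Rmult_lt_0_compat; [exact P1 | apply exp_pos]).
  exists (2 + D). split; [lra|]. intros x B Ix HB KB.
  assert (K2 : forall t, Rmin e x <= t <= Rmax e x ->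
    Rabs (g 2%nat t) <= D * Rpower B (a * a)).
  { intros t Ht. eapply Rle_trans.
    - apply (K1 t (C0 * Rpower B a)).
      + exact (Rmin_Rmax_I01 _ _ _ Ie Ix Ht).
      + apply Rmult_lt_0_compat; [exact P0 | apply exp_pos].
      + intros u Hu. assert (Hu' := Rmin_Rmax_trans _ _ _ _ Ht Hu).
        apply K0; trivial.
        * exact (Rmin_Rmax_I01 _ _ _ Ie Ix Hu').
        * intros v Hv. apply KB. exact (Rmin_Rmax_trans _ _ _ _ Hu' Hv).
    - rewrite <- Rpower_mult_distr, Rpower_mult by (trivial; apply exp_pos).
      unfold D. lra. }
  set (h := Rpower B ((1 - a * a) / 2)).
  assert (L := flat_landau (g O) (g 1%nat) (g 2%nat) e x B _ h (Hd _) (Hd _) (He _) Ie Ix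
    (exp_pos _) (Rlt_le _ _ HB) KB K2).
  eapply Rle_trans; [exact L|]. apply Req_le.
  rewrite Rmult_assoc. unfold h. rewrite <- Rpower_plus.
  unfold Rdiv at 1. rewrite <- Rpower_Ropp.
  rewrite <- (Rpower_1 B HB) at 1. rewrite Rmult_assoc, <- Rpower_plus.
  replace (1 + - ((1 - a * a) / 2)) with ((1 + a * a) / 2) by field.
  replace (a * a + (1 - a * a) / 2) with ((1 + a * a) / 2) by field.
  ring.
Qed.

(** Under [a -> (1 + a * a) / 2], started at 0, the defect d = 1 - a evolves by d -> d - d^2 / 2 and
    hence decays like 2 / n. Each iteration consumes further derivatives of [g], which is where
    smoothness of all orders enters. *)
Lemma flat_power_bound_near_1 (eps : R) :
  0 < eps -> exists a, 1 - eps <= a <= 1 /\ flat_power_bound a.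
Proof.
  intros Heps.
  assert (Hn : forall n : nat,
    exists a, 0 <= 1 - a <= 2 / (INR n + 2) /\ flat_power_bound a).
  { induction n as [|n [a [Ha Fa]]].
    - exists 0. split; [simpl; lra | exact flat_power_bound_0].
    - exists ((1 + a * a) / 2). split; [|exact (flat_power_bound_step a Fa)].
      rewrite S_INR. pose proof (pos_INR n) as Pn. set (m := INR n) in *.
      assert (H1 : 2 / (m + 2) <= 1).
      { apply (Rmult_le_reg_r (m + 2)); [lra|]. unfold Rdiv.
        rewrite Rmult_assoc, Rinv_l; lra. }
      set (q := 2 / (m + 2)) in *.
      split; [nra|].
      (* As d -> d - d^2 / 2 is increasing on [0,1], it suffices to apply it to the bound [q]; the
         inequality amounts to (m + 1)(m + 3) <= (m + 2)^2. *)
      assert (H2 : q - q * q / 2 <= 2 / (m + 1 + 2)).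
      { replace (2 / (m + 1 + 2)) with (q - q * q / 2 + 2 / ((m + 2) * (m + 2) * (m + 3)))
          by (unfold q; field; lra).
        assert (0 < 2 / ((m + 2) * (m + 2) * (m + 3))).
        { apply Rdiv_lt_0_compat; [lra|]. repeat apply Rmult_lt_0_compat; lra. }
        lra. }
      nra. }
  destruct (INR_unbounded (2 / eps)) as [n Hnn].
  destruct (Hn n) as [a [Ha Fa]]. exists a. split; [|exact Fa].
  pose proof (pos_INR n).
  assert (2 / (INR n + 2) <= eps).
  { apply (Rmult_le_reg_r (INR n + 2)); [lra|].
    replace (2 / (INR n + 2) * (INR n + 2)) with 2 by (field; lra).
    assert (2 / eps * eps = 2) by (field; lra). nra. }
  lra.
Qed.

Lemma Rpower_le_small (u s t : R) : 0 < u <= 1 -> s <= t -> Rpower u t <= Rpower u s.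
Proof.
  intros Hu Hst. unfold Rpower.
  assert (ln u <= 0) by (rewrite <- ln_1; apply ln_le; lra).
  destruct (Rle_lt_or_eq_dec (t * ln u) (s * ln u)) as [L|E]; [nra| |].
  - apply Rlt_le, exp_increasing, L.
  - rewrite E. apply Rle_refl.
Qed.

Lemma flat_deriv_bound (g : nat -> R -> R) (e s : R) (S : R -> Prop) :
  I01 e -> (forall j, has_deriv01 (g j) (g (Datatypes.S j))) ->
  (forall j, g j e = 0) ->
  (forall x, S x -> I01 x /\ 0 < g O x <= 1) ->
  (forall eps, 0 < eps -> exists C, 0 < C /\ forall x t, S x ->
    Rmin e x <= t <= Rmax e x -> Rabs (g O t) <= C * Rpower (g O x) (1 - eps)) ->
  0 < s < 1 ->
  exists C, 0 < C /\ forall x, S x -> Rabs (g 1%nat x) <= C * Rpower (g O x) s.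
Proof.
  intros Ie Hd He HS Hreg Hs.
  (* The loss 1 - s is split evenly between almost monotonicity and interpolation: a (1 - eps) >= (1
     - eps)^2 >= 1 - 2 eps = s. *)
  set (eps := (1 - s) / 2). assert (Peps : 0 < eps) by (unfold eps; lra).
  destruct (Hreg eps Peps) as [C [PC KC]].
  destruct (flat_power_bound_near_1 eps Peps) as [a [Ha Fa]].
  destruct (Fa g e Ie Hd He) as [C' [PC' KC']].
  exists (C' * Rpower C a). split.
  { apply Rmult_lt_0_compat; [exact PC' | apply exp_pos]. }
  intros x Sx. destruct (HS x Sx) as [Ix Px].
  eapply Rle_trans.
  { apply (KC' x (C * Rpower (g O x) (1 - eps)) Ix).
    - apply Rmult_lt_0_compat; [exact PC | apply exp_pos].
    - intros t. exact (KC x t Sx). }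
  rewrite <- Rpower_mult_distr, Rpower_mult by (trivial; apply exp_pos).
  rewrite Rmult_assoc. apply Rmult_le_compat_l; [lra|].
  apply Rmult_le_compat_l; [apply Rlt_le, exp_pos|].
  apply Rpower_le_small; [exact Px|]. unfold eps in *. nra.
Qed.

(** * Inverse iterates and their derivatives *)

Lemma iter_dinv_dfun (f : Diff01) (n : nat) (x : R) :
  I01 x -> Nat.iter n (dinv f) (Nat.iter n (dfun f) x) = x.
Proof.
  revert x. induction n as [|n IH]; intros x Hx; [reflexivity|].
  rewrite (Nat.iter_succ_r n _ (dfun f)).
  change (dinv f (Nat.iter n (dinv f) (Nat.iter n (dfun f) (dfun f x))) = x).
  rewrite IH by (apply dfun_maps, Hx). apply dinv_dfun, Hx.
Qed.

Lemma iter_dfun_dinv (f : Diff01) (n : nat) (x : R) :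
  I01 x -> Nat.iter n (dfun f) (Nat.iter n (dinv f) x) = x.
Proof.
  revert x. induction n as [|n IH]; intros x Hx; [reflexivity|].
  rewrite (Nat.iter_succ_r n _ (dinv f)).
  change (dfun f (Nat.iter n (dfun f) (Nat.iter n (dinv f) (dinv f x))) = x).
  rewrite IH by (apply dinv_maps, Hx). apply dfun_dinv, Hx.
Qed.

(** The chain rule for f^(-n) o f^n = id. It converts bounds on one of (f^n)' and (f^(-n))' into
    reciprocal bounds on the other. *)
Lemma deriv01_iter_inverse (f : Diff01) (n : nat) (x : R) :
  I01 x ->
  deriv01 (Nat.iter n (dfun f)) x *
  deriv01 (Nat.iter n (dinv f)) (Nat.iter n (dfun f) x) = 1.
Proof.
  intros Hx.
  destruct (has_deriv01_iter _ _ n (dfun_maps f) (smooth01_has_deriv01 _ 0 (dfun_smooth f)))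
    as [If [Hf _]].
  destruct (has_deriv01_iter _ _ n (dinv_maps f) (smooth01_has_deriv01 _ 0 (dinv_smooth f)))
    as [_ [Hi _]].
  assert (D := D_in_comp01 _ _ _ _ x If Hx (Hf x Hx) (Hi _ (If x Hx))).
  apply (D_in_ext_on _ (fun t => t)) in D; [|exact (iter_dinv_dfun f n)|exact Hx].
  rewrite <- (deriv01_unique _ _ x Hx D).
  exact (deriv01_unique _ (fun _ => 1) x Hx (Dx I01 x)).
Qed.

(** [c] is the reciprocal of a bound for the derivative of the inverse; the absolute value spares a
    discussion of the sign of f'. *)
Lemma deriv01_dfun_lower (f : Diff01) :
  exists c, 0 < c /\ forall x, I01 x -> c <= Rabs (deriv01 f x).
Proof.
  destruct (continuous01_bounded _
    (continuous01_deriv01_iter _ 1 (dinv_maps f) (dinv_smooth f))) as [M [PM KM]].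
  exists (/ M). split; [apply Rinv_0_lt_compat, PM|]. intros x Hx.
  pose proof (deriv01_iter_inverse f 1 x Hx) as E.
  specialize (KM _ (dfun_maps f x Hx)). simpl in E, KM.
  apply (f_equal Rabs) in E. rewrite Rabs_mult, Rabs_R1 in E.
  change (deriv01 (fun x => f x) x) with (deriv01 f x) in E.
  apply (Rmult_le_reg_r M); [exact PM|]. rewrite Rinv_l by lra. rewrite <- E.
  apply Rmult_le_compat_l; [apply Rabs_pos | exact KM].
Qed.

(** * Derivatives of the displacement and the bound on phi' *)

(** The successive derivatives of phi(x) = f(x) - x: the subtracted term is x, then 1, then 0, so
    from order two on the derivatives of f itself serve. *)
Definition displacement_jet (f : Diff01) (j : nat) : R -> R :=
  match j with
  | O => displacement f
  | 1%nat => fun x => deriv01 f x - 1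
  | _ => derivn01 j f
  end.

Lemma displacement_jet_has_deriv01 (f : Diff01) (j : nat) :
  has_deriv01 (displacement_jet f j) (displacement_jet f (S j)).
Proof.
  intros x Hx. destruct j as [|[|j]].
  - exact (Dminus _ _ _ _ _ x (dfun_smooth f 0%nat x Hx) (Dx I01 x)).
  - assert (H := Dminus _ _ _ _ _ x (dfun_smooth f 1%nat x Hx) (Dconst I01 1 x)).
    unfold D_in in *. rewrite Rminus_0_r in H. exact H.
  - exact (dfun_smooth f (S (S j)) x Hx).
Qed.

Lemma displacement_jet_flat (f : Diff01) (e : R) (j : nat) :
  flat_fixed_points f e -> displacement_jet f j e = 0.
Proof.
  intros [[_ E] [E1 Ej]]. destruct j as [|[|j]]; simpl.
  - unfold displacement. lra.
  - lra.
  - apply (Ej (S (S j))). lia.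
Qed.

Lemma displacement_le_1 (f : Diff01) (x : R) : I01 x -> displacement f x <= 1.
Proof.
  intros Hx. pose proof (dfun_maps f x Hx). unfold displacement, I01 in *. lra.
Qed.

Definition open01 (x : R) : Prop := 0 < x < 1.

Lemma open01_I01 (x : R) : open01 x -> I01 x.
Proof. unfold open01, I01. lra. Qed.

(** Each half of the interval is handled by [flat_deriv_bound], with the adjacent endpoint as flat
    point and the open half as the set [S]. *)
Lemma displacement_deriv_bound (f : Diff01) (s : R) :
  flat_fixed_points f 0 -> flat_fixed_points f 1 ->
  (forall x : R, 0 < x < 1 -> 0 < displacement f x) ->
  (forall eps : R, 0 < eps ->
     exists C : R, 0 < C /\
       (forall x y : R, 0 < y -> y < x -> x < 1 / 2 ->
          displacement f y <= C * Rpower (displacement f x) (1 - eps)) /\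
       (forall x y : R, 1 / 2 < x -> x < y -> y < 1 ->
          displacement f y <= C * Rpower (displacement f x) (1 - eps))) ->
  0 < s < 1 ->
  exists C, 0 < C /\ forall x, open01 x ->
    Rabs (deriv01 f x - 1) <= C * Rpower (displacement f x) s.
Proof.
  intros F0 F1 Hpos Hreg Hs.
  assert (Hjet : forall e (S : R -> Prop), (e = 0 \/ e = 1) ->
    (forall x, S x -> open01 x) ->
    (forall eps, 0 < eps -> exists C, 0 < C /\ forall x y, S x ->
       Rmin e x < y < Rmax e x ->
       displacement f y <= C * Rpower (displacement f x) (1 - eps)) ->
    exists C, 0 < C /\ forall x, S x ->
      Rabs (deriv01 f x - 1) <= C * Rpower (displacement f x) s).
  { intros e S He HS HC.
    assert (Fe : flat_fixed_points f e) by (destruct He; subst; assumption).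
    assert (Ie : I01 e) by (unfold I01; lra).
    apply (flat_deriv_bound (displacement_jet f) e s S Ie); trivial.
    - exact (displacement_jet_has_deriv01 f).
    - intros j. exact (displacement_jet_flat f e j Fe).
    - intros x Sx. pose proof (HS x Sx) as Ox. split; [exact (open01_I01 x Ox)|].
      split; [exact (Hpos x Ox) | exact (displacement_le_1 f x (open01_I01 x Ox))].
    - intros eps Heps. destruct (HC eps Heps) as [C [PC KC]].
      (* The extra 1 covers [t = x], which the strict inequalities of the hypothesis omit: there
         phi(x) <= phi(x)^(1 - eps) because phi <= 1. *)
      exists (C + 1). split; [lra|]. intros x t Sx Ht. pose proof (HS x Sx) as Ox.
      change (Rabs (displacement f t) <= (C + 1) * Rpower (displacement f x) (1 - eps)).
      set (p := Rpower (displacement f x) (1 - eps)).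
      assert (Pp : 0 < p) by apply exp_pos.
      assert (Px := Hpos x Ox).
      destruct (Req_dec t e) as [->|Ne].
      { replace (displacement f e) with 0
          by (symmetry; exact (displacement_jet_flat f e 0 Fe)).
        rewrite Rabs_R0. nra. }
      destruct (Req_dec t x) as [->|Nx].
      { rewrite Rabs_pos_eq by lra. apply Rle_trans with p; [|nra].
        rewrite <- (Rpower_1 (displacement f x)) at 1 by exact Px.
        apply Rpower_le_small; [|lra].
        split; [exact Px | exact (displacement_le_1 f x (open01_I01 x Ox))]. }
      assert (Ht' : Rmin e x < t < Rmax e x).
      { unfold Rmin, Rmax in *. destruct (Rle_dec e x); lra. }
      assert (Ot : open01 t).
      { unfold open01, Rmin, Rmax in *. destruct (Rle_dec e x); lra. }
      rewrite Rabs_pos_eq by (apply Rlt_le, Hpos, Ot).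
      specialize (KC x t Sx Ht'). fold p in KC. lra. }
  destruct (Hjet 0 (fun x => 0 < x < 1 / 2)) as [C0 [P0 K0]].
  { left; reflexivity. }
  { unfold open01; intros; lra. }
  { intros eps Heps. destruct (Hreg eps Heps) as [C [PC [KC _]]].
    exists C; split; [exact PC|]. intros x y Hx Hy.
    rewrite Rmin_left, Rmax_right in Hy by lra. apply KC; lra. }
  destruct (Hjet 1 (fun x => 1 / 2 < x < 1)) as [C1 [P1 K1]].
  { right; reflexivity. }
  { unfold open01; intros; lra. }
  { intros eps Heps. destruct (Hreg eps Heps) as [C [PC [_ KC]]].
    exists C; split; [exact PC|]. intros x y Hx Hy.
    rewrite Rmin_right, Rmax_left in Hy by lra. apply KC; lra. }
  (* The midpoint belongs to neither half; [m] is the constant that works at this single point. *)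
  set (m := Rabs (deriv01 f (1 / 2) - 1) / Rpower (displacement f (1 / 2)) s).
  assert (Pm : 0 <= m).
  { apply Rmult_le_pos; [apply Rabs_pos | apply Rlt_le, Rinv_0_lt_compat, exp_pos]. }
  exists (C0 + C1 + m). split; [lra|]. intros x Ox. unfold open01 in Ox.
  assert (Pp : 0 < Rpower (displacement f x) s) by apply exp_pos.
  destruct (Rtotal_order x (1 / 2)) as [L|[->|L]].
  - eapply Rle_trans; [apply K0; lra | apply Rmult_le_compat_r; lra].
  - apply Rle_trans with (m * Rpower (displacement f (1 / 2)) s).
    + unfold m. apply Req_le. field. lra.
    + apply Rmult_le_compat_r; lra.
  - eapply Rle_trans; [apply K1; lra | apply Rmult_le_compat_r; lra].
Qed.

(** * Interior orbits and distortion of iterates *)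

Lemma dfun_open01 (f : Diff01) (x : R) :
  (forall x : R, 0 < x < 1 -> 0 < displacement f x) -> open01 x -> open01 (f x).
Proof.
  intros Hpos Ox. pose proof (Hpos x Ox) as P. pose proof (open01_I01 x Ox) as Ix.
  pose proof (dfun_maps f x Ix) as If. unfold displacement, open01, I01 in *.
  assert (f x <> 1).
  { intros E. pose proof (dinv_dfun f x Ix) as A.
    assert (I1 : I01 1) by (unfold I01; lra).
    pose proof (dinv_dfun f 1 I1) as B. rewrite dfun_1 in B. rewrite E in A. lra. }
  lra.
Qed.

Lemma iter_open01 (f : Diff01) (n : nat) (x : R) :
  (forall x : R, 0 < x < 1 -> 0 < displacement f x) ->
  open01 x -> open01 (Nat.iter n f x).
Proof.
  intros Hpos Ox. induction n as [|n IH]; [exact Ox | exact (dfun_open01 f _ Hpos IH)].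
Qed.

Lemma displacement_step (f : Diff01) (x : R) :
  (forall x : R, 0 < x < 1 -> 0 < displacement f x) -> open01 x ->
  exists t, x <= t <= f x /\ displacement f (f x) = deriv01 f t * displacement f x.
Proof.
  intros Hpos Ox. pose proof (open01_I01 x Ox) as Ix. pose proof (Hpos x Ox) as P.
  destruct (MVT01 f _ x (f x) (smooth01_has_deriv01 _ 0 (dfun_smooth f)) Ix (dfun_maps f x Ix))
    as [t [Ht E]].
  unfold displacement in *. exists t. split; [|exact E].
  rewrite Rmin_left, Rmax_right in Ht by lra. exact Ht.
Qed.

(** Lets f'(t) in [displacement_step] be replaced by its absolute value without a prior proof that
    f' is positive. *)
Lemma Rabs_mult_pos (d p q : R) : 0 < p -> 0 < q -> q = d * p -> q = Rabs d * p.
Proof.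
  intros Hp Hq E. rewrite <- (Rabs_pos_eq q), E, Rabs_mult, (Rabs_pos_eq p) by lra.
  reflexivity.
Qed.

(* By [displacement_step] the ratio of consecutive displacements is [f'] at a point within
   distance [phi(x_k)] of [x_k]; the errors add up to a multiple of [x_n - x]. *)
Lemma iter_distortion (f : Diff01) :
  (forall x : R, 0 < x < 1 -> 0 < displacement f x) ->
  exists K, 0 < K /\ forall (n : nat) (x : R), open01 x ->
    displacement f x * Rabs (deriv01 (Nat.iter n f) x)
      <= K * displacement f (Nat.iter n f x) /\
    displacement f (Nat.iter n f x)
      <= K * (displacement f x * Rabs (deriv01 (Nat.iter n f) x)).
Proof.
  intros Hpos.
  destruct (deriv01_dfun_lower f) as [c [Pc Kc]].
  pose proof (smooth01_has_deriv01 f 0 (dfun_smooth f)) as H0.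
  pose proof (smooth01_has_deriv01 f 1 (dfun_smooth f)) as H1.
  destruct (continuous01_bounded _
    (has_deriv01_continuous01 _ _ (smooth01_has_deriv01 f 2 (dfun_smooth f))))
    as [M [PM KM]].
  (* A Lipschitz constant for log |f'|: [M] bounds |f''| and [c] bounds |f'| from below. *)
  set (L := M / c).
  assert (PL : 0 < L) by (apply Rdiv_lt_0_compat; assumption).
  assert (Hlog : forall x t, I01 x -> I01 t ->
    Rabs (deriv01 f x) <= Rabs (deriv01 f t) * exp (L * Rabs (x - t))).
  { intros x t Ix It.
    destruct (MVT01 _ _ t x H1 It Ix) as [u [Hu E]].
    change (deriv01 f x - deriv01 f t = derivn01 2 f u * (x - t)) in E.
    assert (E' : deriv01 f x = deriv01 f t + derivn01 2 f u * (x - t)) by lra.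
    rewrite E'. eapply Rle_trans; [apply Rabs_triang|]. rewrite Rabs_mult.
    specialize (KM u (Rmin_Rmax_I01 _ _ _ It Ix Hu)).
    pose proof (Kc t It) as Kt. pose proof (Rabs_pos (x - t)) as Pd.
    pose proof (exp_ineq1_le (L * Rabs (x - t))) as Ee.
    assert (ML : M = L * c) by (unfold L; field; lra).
    assert (Rabs (derivn01 2 f u) * Rabs (x - t) <= L * c * Rabs (x - t))
      by (apply Rmult_le_compat_r; lra).
    assert (L * c * Rabs (x - t) <= L * Rabs (deriv01 f t) * Rabs (x - t)).
    { apply Rmult_le_compat_r; [exact Pd|]. apply Rmult_le_compat_l; lra. }
    assert (Rabs (deriv01 f t) * (1 + L * Rabs (x - t)) <=
            Rabs (deriv01 f t) * exp (L * Rabs (x - t)))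
      by (apply Rmult_le_compat_l; [apply Rabs_pos | exact Ee]).
    lra. }
  (* Keeping the exact distance x_n - x in the exponent makes the induction telescope; it is
     replaced by 1 only at the end. *)
  assert (Hn : forall (n : nat) (x : R), open01 x ->
    displacement f x * Rabs (deriv01 (Nat.iter n f) x)
      <= exp (L * (Nat.iter n f x - x)) * displacement f (Nat.iter n f x) /\
    displacement f (Nat.iter n f x)
      <= exp (L * (Nat.iter n f x - x)) *
         (displacement f x * Rabs (deriv01 (Nat.iter n f) x))).
  { intros n x Ox. pose proof (open01_I01 x Ox) as Ix.
    induction n as [|n [A B]].
    - assert (E0 : deriv01 (Nat.iter 0 f) x = 1)
        by exact (deriv01_unique _ (fun _ => 1) x Ix (Dx I01 x)).
      change (Nat.iter 0 f x) with x. rewrite E0, Rabs_R1, Rminus_diag, Rmult_0_r, exp_0. lra.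
    - destruct (has_deriv01_iter f _ n (dfun_maps f) H0) as [_ [_ E]].
      rewrite (E x Ix), Rabs_mult.
      pose proof (iter_open01 f n x Hpos Ox) as Oy.
      set (y := Nat.iter n f x) in *. change (Nat.iter (S n) f x) with (f y).
      destruct (displacement_step f y Hpos Oy) as [t [Ht Et]].
      pose proof (Hpos y Oy) as Py. pose proof (dfun_open01 f y Hpos Oy) as Ofy.
      apply Rabs_mult_pos in Et; [|exact Py|exact (Hpos _ Ofy)].
      assert (It : I01 t) by (unfold I01, open01 in *; lra).
      pose proof (open01_I01 y Oy) as Iy.
      assert (Hexp : exp (L * Rabs (y - t)) <= exp (L * (f y - y))).
      { assert (Rabs (y - t) <= f y - y) by (apply Rabs_le; lra).
        destruct (Rle_lt_or_eq_dec (L * Rabs (y - t)) (L * (f y - y))) as [l|e].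
        - apply Rmult_le_compat_l; lra.
        - apply Rlt_le, exp_increasing, l.
        - rewrite e. apply Rle_refl. }
      assert (A1 := Hlog y t Iy It). assert (B1 := Hlog t y It Iy).
      rewrite (Rabs_minus_sym t y) in B1.
      replace (L * (f y - x)) with (L * (f y - y) + L * (y - x)) by ring.
      rewrite exp_plus, Et.
      set (E1 := exp (L * (f y - y))) in *. set (E2 := exp (L * (y - x))) in *.
      set (Q := displacement f x * Rabs (deriv01 (Nat.iter n f) x)) in *.
      change (derivn01 1 f y) with (deriv01 f y).
      assert (PQ : 0 <= Q).
      { apply Rmult_le_pos; [apply Rlt_le, Hpos, Ox | apply Rabs_pos]. }
      pose proof (Rabs_pos (deriv01 f y)) as Py'. pose proof (Rabs_pos (deriv01 f t)) as Pt'.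
      assert (P1 : 0 < E1) by apply exp_pos. assert (P2 : 0 < E2) by apply exp_pos.
      set (dy := Rabs (deriv01 f y)) in *. set (dt := Rabs (deriv01 f t)) in *.
      assert (A2 : dy <= dt * E1).
      { eapply Rle_trans; [exact A1|]. apply Rmult_le_compat_l; assumption. }
      assert (B2 : dt <= dy * E1).
      { eapply Rle_trans; [exact B1|]. apply Rmult_le_compat_l; assumption. }
      split.
      + replace (displacement f x * (dy * Rabs (deriv01 (Nat.iter n f) x))) with (dy * Q)
          by (unfold Q; ring).
        replace (E1 * E2 * (dt * displacement f y))
          with ((dt * E1) * (E2 * displacement f y)) by ring.
        apply Rmult_le_compat; assumption.
      + replace (E1 * E2 * (displacement f x * (dy * Rabs (deriv01 (Nat.iter n f) x))))
          with ((dy * E1) * (E2 * Q)) by (unfold Q; ring).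
        apply Rmult_le_compat; trivial. lra. }
  exists (exp L). split; [apply exp_pos|]. intros n x Ox.
  destruct (Hn n x Ox) as [A B].
  pose proof (iter_open01 f n x Hpos Ox) as Oy.
  assert (Hexp : exp (L * (Nat.iter n f x - x)) <= exp L).
  { apply Rlt_le, exp_increasing. unfold open01 in *. nra. }
  split.
  - eapply Rle_trans; [exact A|]. apply Rmult_le_compat_r; [apply Rlt_le, Hpos, Oy | exact Hexp].
  - eapply Rle_trans; [exact B|]. apply Rmult_le_compat_r; [|exact Hexp].
    apply Rmult_le_pos; [apply Rlt_le, Hpos, Ox | apply Rabs_pos].
Qed.

(** * Polynomial growth from a slow recursion *)

(** While u_k stays below 2 u_0, each step multiplies it by at most 1 + q with q = C (2 u_0)^s, and
    n q <= 1/2 keeps n such steps from exceeding 2 u_0. *)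
Lemma slow_growth_doubling (u : nat -> R) (C s : R) (n : nat) :
  0 < C -> 0 <= s -> (forall k, (k <= n)%nat -> 0 < u k) ->
  (forall k, (k < n)%nat -> u (S k) <= u k * (1 + C * Rpower (u k) s)) ->
  INR n * (C * Rpower (2 * u O) s) <= 1 / 2 ->
  u n <= 2 * u O.
Proof.
  intros PC Ps Pu Hu Hn.
  set (q := C * Rpower (2 * u O) s) in *.
  assert (Pq : 0 < q) by (apply Rmult_lt_0_compat; [exact PC | apply exp_pos]).
  assert (P0 := Pu O (Nat.le_0_l n)).
  (* This linear majorant survives a step because (1 + 2 k q)(1 + q) <= 1 + 2 (k + 1) q as soon as k
     q <= 1/2. *)
  assert (Hk : forall k, (k <= n)%nat -> u k <= u O * (1 + 2 * INR k * q)).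
  { induction k as [|k IH]; intros Hkn; [simpl; lra|].
    specialize (IH ltac:(lia)). specialize (Hu k ltac:(lia)).
    pose proof (Pu k ltac:(lia)) as Pk.
    assert (Hkq : INR k * q <= 1 / 2).
    { eapply Rle_trans; [|exact Hn]. apply Rmult_le_compat_r; [lra|]. apply le_INR; lia. }
    pose proof (pos_INR k). assert (0 <= INR k * q) by (apply Rmult_le_pos; lra).
    assert (Hr : Rpower (u k) s <= Rpower (2 * u O) s).
    { apply Rle_Rpower_l; [exact Ps|]. split; [exact Pk|]. nra. }
    assert (Hr' : C * Rpower (u k) s <= q) by (apply Rmult_le_compat_l; lra).
    rewrite S_INR.
    apply Rle_trans with (u k * (1 + q)).
    { eapply Rle_trans; [exact Hu|]. apply Rmult_le_compat_l; lra. }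
    apply Rle_trans with (u O * (1 + 2 * INR k * q) * (1 + q)).
    { apply Rmult_le_compat_r; lra. }
    rewrite Rmult_assoc. apply Rmult_le_compat_l; [lra|]. nra. }
  specialize (Hk n (Nat.le_refl n)). nra.
Qed.

Lemma Rpower_ge_1 (x p : R) : 1 <= x -> 0 <= p -> 1 <= Rpower x p.
Proof.
  intros Hx Hp. rewrite <- (Rpower_O x) by lra. apply Rle_Rpower; assumption.
Qed.

(** The summand 2 of the constant serves small u_0, by doubling. For large u_0 the bound u_n <= 1 is
    enough, and the other summand comes from solving n C (2 u_0)^s > 1/2 for u_0. *)
Lemma slow_growth_polynomial (u : nat -> R) (C s : R) (n : nat) :
  0 < C -> 0 < s -> (1 <= n)%nat -> (forall k, (k <= n)%nat -> 0 < u k) ->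
  (forall k, (k < n)%nat -> u (S k) <= u k * (1 + C * Rpower (u k) s)) ->
  u n <= 1 ->
  u n <= (2 + 2 * Rpower (2 * C) (1 / s)) * Rpower (INR n) (1 / s) * u O.
Proof.
  intros PC Ps Hn Pu Hu U1.
  assert (Hp : 0 <= 1 / s).
  { apply Rlt_le, Rdiv_lt_0_compat; lra. }
  apply le_INR in Hn as Hn'. simpl in Hn'.
  pose proof (Rpower_ge_1 _ _ Hn' Hp) as G.
  assert (P0 := Pu O (Nat.le_0_l n)).
  assert (PR : 0 < Rpower (2 * C) (1 / s)) by apply exp_pos.
  destruct (Rle_lt_dec (INR n * (C * Rpower (2 * u O) s)) (1 / 2)) as [L|L].
  - pose proof (slow_growth_doubling u C s n PC (Rlt_le _ _ Ps) Pu Hu L).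
    assert (2 * 1 <= (2 + 2 * Rpower (2 * C) (1 / s)) * Rpower (INR n) (1 / s))
      by (apply Rmult_le_compat; lra).
    nra.
  - assert (H1 : 1 <= 2 * C * INR n * Rpower (2 * u O) s) by lra.
    apply (Rpower_ge_1 _ (1 / s)) in H1; [|exact Hp].
    rewrite <- Rpower_mult_distr in H1 by
      (try apply exp_pos; apply Rmult_lt_0_compat; lra).
    rewrite <- Rpower_mult_distr in H1 by lra.
    rewrite Rpower_mult in H1.
    replace (s * (1 / s)) with 1 in H1 by (field; lra).
    rewrite Rpower_1 in H1 by lra.
    assert (0 <= 2 * Rpower (INR n) (1 / s) * u O).
    { apply Rmult_le_pos; lra. }
    lra.
Qed.

(** Both inequalities have the form of the slow recursion; the second is a step of the orbit read
    backwards, so its right side involves only the value at f(x). *)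
Lemma displacement_step_slow (f : Diff01) (s : R) :
  (forall x : R, 0 < x < 1 -> 0 < displacement f x) -> 0 < s ->
  (exists C, 0 < C /\ forall x, open01 x ->
    Rabs (deriv01 f x - 1) <= C * Rpower (displacement f x) s) ->
  exists C, 0 < C /\ forall x, open01 x ->
    displacement f (f x)
      <= displacement f x * (1 + C * Rpower (displacement f x) s) /\
    displacement f x
      <= displacement f (f x) * (1 + C * Rpower (displacement f (f x)) s).
Proof.
  intros Hpos Ps [C [PC KC]].
  destruct (deriv01_dfun_lower f) as [c [Pc Kc]].
  destruct (continuous01_bounded _
    (has_deriv01_continuous01 _ _ (displacement_jet_has_deriv01 f 1))) as [M [PM KM]].
  (* [C2] absorbs the passage from the mean value point t to x, where phi(t) <= (1 + M) phi(x); [C3]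
     absorbs that from x to f(x), where phi(x) <= phi(f(x)) / c. *)
  set (C2 := C * Rpower (1 + M) s). set (C3 := C2 * Rpower (1 / c) s * (1 / c)).
  assert (P2 : 0 < C2) by (apply Rmult_lt_0_compat; [exact PC | apply exp_pos]).
  assert (Pic : 0 < 1 / c) by (apply Rdiv_lt_0_compat; lra).
  assert (P3 : 0 < C3).
  { apply Rmult_lt_0_compat; [apply Rmult_lt_0_compat; [exact P2 | apply exp_pos] | exact Pic]. }
  exists (C2 + C3). split; [lra|]. intros x Ox.
  destruct (displacement_step f x Hpos Ox) as [t [Ht Et]].
  pose proof (dfun_open01 f x Hpos Ox) as Ofx.
  pose proof (Hpos x Ox) as Px. pose proof (Hpos _ Ofx) as Pfx.
  assert (Ot : open01 t) by (unfold open01 in *; lra).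
  pose proof (open01_I01 x Ox) as Ix. pose proof (open01_I01 t Ot) as It.
  assert (Ht1 : displacement f t <= (1 + M) * displacement f x).
  { destruct (MVT01 _ _ x t (displacement_jet_has_deriv01 f 0) Ix It) as [v [Hv Ev]].
    specialize (KM v (Rmin_Rmax_I01 _ _ _ Ix It Hv)).
    change (displacement f t - displacement f x = displacement_jet f 1 v * (t - x)) in Ev.
    pose proof (Rle_abs (displacement_jet f 1 v)).
    assert (displacement_jet f 1 v * (t - x) <= M * displacement f x).
    { apply Rle_trans with (M * (t - x)).
      - apply Rmult_le_compat_r; lra.
      - apply Rmult_le_compat_l; [lra|]. unfold displacement. lra. }
    lra. }
  assert (Hd : Rabs (deriv01 f t - 1) <= C2 * Rpower (displacement f x) s).
  { eapply Rle_trans; [exact (KC t Ot)|]. unfold C2. rewrite Rmult_assoc.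
    apply Rmult_le_compat_l; [lra|]. rewrite Rpower_mult_distr by lra.
    apply Rle_Rpower_l; [lra|]. split; [exact (Hpos t Ot) | exact Ht1]. }
  pose proof (Rle_abs (deriv01 f t - 1)) as A1.
  pose proof (Rle_abs (- (deriv01 f t - 1))) as A2. rewrite Rabs_Ropp in A2.
  assert (R1 : 0 < Rpower (displacement f x) s) by apply exp_pos.
  assert (R2 : 0 < Rpower (displacement f (f x)) s) by apply exp_pos.
  split.
  - rewrite Et, (Rmult_comm (deriv01 f t)). apply Rmult_le_compat_l; [lra|].
    assert (0 < C3 * Rpower (displacement f x) s) by (apply Rmult_lt_0_compat; assumption).
    lra.
  - assert (B : displacement f x <= 1 / c * displacement f (f x)).
    { rewrite (Rabs_mult_pos _ _ _ Px Pfx Et).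
      specialize (Kc t It).
      apply Rle_trans with (1 / c * (c * displacement f x)).
      - apply Req_le. field. lra.
      - apply Rmult_le_compat_l; [lra|]. apply Rmult_le_compat_r; lra. }
    assert (B' : C2 * Rpower (displacement f x) s <=
      C2 * Rpower (1 / c) s * Rpower (displacement f (f x)) s).
    { rewrite Rmult_assoc, Rpower_mult_distr by assumption.
      apply Rmult_le_compat_l; [lra|]. apply Rle_Rpower_l; lra. }
    assert (B3 : (1 - deriv01 f t) * displacement f x <=
       C3 * Rpower (displacement f (f x)) s * displacement f (f x)).
    { apply Rle_trans with (C2 * Rpower (displacement f x) s * displacement f x).
      - apply Rmult_le_compat_r; lra.
      - replace (C3 * Rpower (displacement f (f x)) s * displacement f (f x)) with
          (C2 * Rpower (1 / c) s * Rpower (displacement f (f x)) s *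
             (1 / c * displacement f (f x))) by (unfold C3; ring).
        apply Rmult_le_compat; trivial; [|lra].
        apply Rlt_le, Rmult_lt_0_compat; assumption. }
    assert (0 <= C2 * Rpower (displacement f (f x)) s * displacement f (f x)).
    { apply Rlt_le, Rmult_lt_0_compat; [apply Rmult_lt_0_compat; assumption | exact Pfx]. }
    lra.
Qed.

(* The backward bound is the forward one for the reversed orbit [x_n, ..., x_0]. *)
Lemma displacement_ratio (f : Diff01) (s : R) :
  (forall x : R, 0 < x < 1 -> 0 < displacement f x) -> 0 < s ->
  (exists C, 0 < C /\ forall x, open01 x ->
    Rabs (deriv01 f x - 1) <= C * Rpower (displacement f x) s) ->
  exists K, 0 < K /\ forall (n : nat) (x : R), (1 <= n)%nat -> open01 x ->
    displacement f (Nat.iter n f x)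
      <= K * Rpower (INR n) (1 / s) * displacement f x /\
    displacement f x
      <= K * Rpower (INR n) (1 / s) * displacement f (Nat.iter n f x).
Proof.
  intros Hpos Ps Hd.
  destruct (displacement_step_slow f s Hpos Ps Hd) as [C [PC KC]].
  exists (2 + 2 * Rpower (2 * C) (1 / s)). split.
  { assert (0 < Rpower (2 * C) (1 / s)) by apply exp_pos. lra. }
  intros n x Hn Ox.
  assert (Oi : forall k, open01 (Nat.iter k f x)) by (intros k; apply iter_open01; assumption).
  split.
  - apply (slow_growth_polynomial (fun k => displacement f (Nat.iter k f x)) C s n); trivial.
    + intros k _. apply Hpos, Oi.
    + intros k _. apply (KC _ (Oi k)).
    + apply displacement_le_1, open01_I01, Oi.
  - assert (S := slow_growth_polynomial
      (fun k => displacement f (Nat.iter (n - k) f x)) C s n PC Ps Hn).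
    cbv beta in S. rewrite Nat.sub_diag, Nat.sub_0_r in S. apply S.
    + intros k _. apply Hpos, Oi.
    + intros k Hk. replace (n - k)%nat with (Datatypes.S (n - Datatypes.S k)) by lia.
      apply (KC _ (Oi _)).
    + apply displacement_le_1, open01_I01, Ox.
Qed.

(** * Upper bound for the growth sequence *)

Lemma deriv01_iter_fixed (f : Diff01) (n : nat) (e : R) :
  I01 e -> f e = e -> deriv01 f e = 1 -> deriv01 (Nat.iter n f) e = 1.
Proof.
  intros Ie Fe De.
  assert (Fn : forall k, Nat.iter k f e = e).
  { induction k as [|k IH]; [reflexivity|]. simpl. rewrite IH. exact Fe. }
  induction n as [|n IH].
  - exact (deriv01_unique _ (fun _ => 1) e Ie (Dx I01 e)).
  - destruct (has_deriv01_iter f _ n (dfun_maps f)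
      (smooth01_has_deriv01 f 0 (dfun_smooth f))) as [_ [_ E]].
    rewrite (E e Ie), Fn, IH. change (derivn01 1 f e) with (deriv01 f e). rewrite De. ring.
Qed.

Lemma growth_ge_inverse (f : Diff01) (n : nat) (y : R) :
  I01 y -> Rabs (deriv01 (Nat.iter n (dinv f)) y) <= growth f n.
Proof.
  intros Iy. unfold growth. eapply Rle_trans; [|apply Rmax_r].
  apply (max01_correct (fun x => Rabs (deriv01 (Nat.iter n (dinv f)) x))); [|exact Iy].
  apply continuous01_abs, continuous01_deriv01_iter; [apply dinv_maps | apply dinv_smooth].
Qed.

(** The value of |(f^(-n))'| at y is the reciprocal of |(f^n)'| at f^(-n)(y), so a lower bound on
    |(f^n)'| takes care of the inverse. *)
Lemma growth_le (f : Diff01) (n : nat) (b : R) :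
  (forall x, I01 x -> Rabs (deriv01 (Nat.iter n f) x) <= b /\
                      1 <= b * Rabs (deriv01 (Nat.iter n f) x)) ->
  growth f n <= b.
Proof.
  intros H. unfold growth. apply Rmax_lub.
  - destruct (max01_correct _ (continuous01_abs _
      (continuous01_deriv01_iter _ n (dfun_maps f) (dfun_smooth f)))) as [[x [Ix <-]] _].
    apply H, Ix.
  - destruct (max01_correct _ (continuous01_abs _
      (continuous01_deriv01_iter _ n (dinv_maps f) (dinv_smooth f)))) as [[y [Iy <-]] _].
    assert (Ix : I01 (Nat.iter n (dinv f) y)).
    { apply (has_deriv01_iter _ _ n (dinv_maps f)
        (smooth01_has_deriv01 _ 0 (dinv_smooth f))). exact Iy. }
    pose proof (deriv01_iter_inverse f n _ Ix) as E. rewrite iter_dfun_dinv in E by exact Iy.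
    apply (f_equal Rabs) in E. rewrite Rabs_mult, Rabs_R1 in E.
    destruct (H _ Ix) as [_ H1].
    pose proof (Rabs_pos (deriv01 (Nat.iter n (dinv f)) y)).
    set (d := Rabs (deriv01 (Nat.iter n (dinv f)) y)) in *.
    apply Rle_trans with (d * (b * Rabs (deriv01 (Nat.iter n f) (Nat.iter n (dinv f) y)))).
    + rewrite <- (Rmult_1_r d) at 1. apply Rmult_le_compat_l; assumption.
    + apply Req_le. transitivity (b * (Rabs (deriv01 (Nat.iter n f) (Nat.iter n (dinv f) y)) * d)).
      * ring.
      * rewrite E. ring.
Qed.

Lemma growth_polynomial_bound (f : Diff01) (s : R) :
  flat_fixed_points f 0 -> flat_fixed_points f 1 ->
  (forall x : R, 0 < x < 1 -> 0 < displacement f x) -> 0 < s ->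
  (exists C, 0 < C /\ forall x, open01 x ->
    Rabs (deriv01 f x - 1) <= C * Rpower (displacement f x) s) ->
  exists K, 0 < K /\ forall n : nat, (1 <= n)%nat ->
    growth f n <= K * Rpower (INR n) (1 / s).
Proof.
  intros F0 F1 Hpos Ps Hd.
  destruct (iter_distortion f Hpos) as [K1 [P1 H1]].
  destruct (displacement_ratio f s Hpos Ps Hd) as [K2 [P2 H2]].
  (* [K1] is the distortion constant and [K2] bounds the ratio of displacements; the added 1 serves
     the endpoints, where phi vanishes and (f^n)' = 1. *)
  exists (K1 * K2 + 1). assert (P12 : 0 < K1 * K2) by (apply Rmult_lt_0_compat; assumption).
  split; [lra|]. intros n Hn. apply growth_le. intros x Ix.
  assert (G : 1 <= Rpower (INR n) (1 / s)).
  { apply Rpower_ge_1; [exact (le_INR 1 n Hn)|]. apply Rlt_le, Rdiv_lt_0_compat; lra. }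
  set (N := Rpower (INR n) (1 / s)) in *.
  assert (Hend : forall e, flat_fixed_points f e ->
    Rabs (deriv01 (Nat.iter n f) e) <= (K1 * K2 + 1) * N /\
    1 <= (K1 * K2 + 1) * N * Rabs (deriv01 (Nat.iter n f) e)).
  { intros e [[Ie Fe] [De _]].
    rewrite (deriv01_iter_fixed f n e Ie Fe De), Rabs_R1. nra. }
  destruct (Req_dec x 0) as [->|N0]; [exact (Hend 0 F0)|].
  destruct (Req_dec x 1) as [->|N1]; [exact (Hend 1 F1)|].
  assert (Ox : open01 x) by (unfold open01, I01 in *; lra).
  destruct (H1 n x Ox) as [A1 B1]. destruct (H2 n x Hn Ox) as [A2 B2]. fold N in A2, B2.
  pose proof (Hpos x Ox) as Px.
  set (d := Rabs (deriv01 (Nat.iter n f) x)) in *. assert (Pd : 0 <= d) by apply Rabs_pos.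
  set (p := displacement f x) in *. set (q := displacement f (Nat.iter n f x)) in *.
  split; apply (Rmult_le_reg_l p); trivial.
  - apply Rle_trans with (K1 * (K2 * N * p)).
    + eapply Rle_trans; [exact A1|]. apply Rmult_le_compat_l; lra.
    + assert (0 < N * p) by (apply Rmult_lt_0_compat; lra). lra.
  - rewrite Rmult_1_r. apply Rle_trans with (K2 * N * (K1 * (p * d))).
    + eapply Rle_trans; [exact B2|]. apply Rmult_le_compat_l; [|exact B1].
      apply Rmult_le_pos; lra.
    + assert (0 <= N * p * d) by (repeat apply Rmult_le_pos; lra). lra.
Qed.

(** * Linear lower bound for infinitely many n *)

Lemma ln_step_le (k : nat) : (1 <= k)%nat -> ln (INR (S k)) - ln (INR k) <= 1 / INR k.
Proof.
  intros Hk. pose proof (le_INR 1 k Hk) as Pk. simpl (INR 1) in Pk.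
  rewrite <- ln_div by (try apply lt_0_INR; try lia; lra).
  rewrite S_INR. replace ((INR k + 1) / INR k) with (1 + 1 / INR k) by (field; lra).
  assert (0 < 1 / INR k) by (apply Rdiv_lt_0_compat; lra).
  rewrite <- (ln_exp (1 / INR k)) at 2. apply ln_le; [lra | apply exp_ineq1_le].
Qed.

Lemma ln_INR_unbounded (A : R) :
  exists N, (2 <= N)%nat /\ forall n, (N <= n)%nat -> A < ln (INR n).
Proof.
  destruct (INR_unbounded (exp A)) as [N HN]. exists (N + 2)%nat. split; [lia|].
  intros n Hn. rewrite <- (ln_exp A). apply ln_increasing; [apply exp_pos|].
  apply Rlt_le_trans with (INR N); [exact HN | apply le_INR; lia].
Qed.

(* The displacements along an orbit sum to at most 1, so they cannot all
   exceed the terms of the harmonic series. *)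
Lemma displacement_small_often (f : Diff01) (x : R) (N : nat) :
  (forall x : R, 0 < x < 1 -> 0 < displacement f x) -> open01 x ->
  exists n, (N <= n)%nat /\ (1 <= n)%nat /\ displacement f (Nat.iter n f x) <= 1 / INR n.
Proof.
  intros Hpos Ox.
  destruct (Classical_Prop.classic (exists n, (N <= n)%nat /\ (1 <= n)%nat /\
    displacement f (Nat.iter n f x) <= 1 / INR n)) as [H|H]; [exact H|exfalso].
  (* Starting at [N + 1] keeps the index positive. From there on the terms 1 / n dominate the
     increments of ln, and the displacements telescope along the orbit: the right side below stays
     under 1 while the left is unbounded. *)
  set (m := (N + 1)%nat).
  assert (Hk : forall k, ln (INR (m + k)) - ln (INR m) <=
    Nat.iter (m + k) f x - Nat.iter m f x).
  { induction k as [|k IH]; [rewrite Nat.add_0_r; lra|].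
    rewrite Nat.add_succ_r.
    assert (L : 1 / INR (m + k) < displacement f (Nat.iter (m + k) f x)).
    { apply Rnot_le_lt. intros L. apply H. exists (m + k)%nat.
      split; [lia|]. split; [lia | exact L]. }
    unfold displacement in L. pose proof (ln_step_le (m + k) ltac:(lia)).
    change (Nat.iter (S (m + k)) f x) with (f (Nat.iter (m + k) f x)). lra. }
  destruct (ln_INR_unbounded (1 + ln (INR m))) as [M [_ HM]].
  specialize (HM (m + M)%nat ltac:(lia)). specialize (Hk M).
  pose proof (iter_open01 f (m + M) x Hpos Ox). pose proof (iter_open01 f m x Hpos Ox).
  unfold open01 in *. lra.
Qed.

Lemma growth_linear_often (f : Diff01) :
  (forall x : R, 0 < x < 1 -> 0 < displacement f x) ->
  exists c, 0 < c /\ forall N : nat, exists n, (N <= n)%nat /\ c * INR n <= growth f n.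
Proof.
  intros Hpos. destruct (iter_distortion f Hpos) as [K [PK HK]].
  assert (Ox : open01 (1 / 2)) by (unfold open01; lra).
  pose proof (Hpos _ Ox) as Px.
  exists (displacement f (1 / 2) / K). split; [apply Rdiv_lt_0_compat; assumption|].
  intros N. destruct (displacement_small_often f (1 / 2) N Hpos Ox) as [n [HN [Hn L]]].
  exists n. split; [exact HN|].
  pose proof (open01_I01 _ Ox) as Ix. pose proof (open01_I01 _ (iter_open01 f n _ Hpos Ox)) as Iy.
  eapply Rle_trans; [|exact (growth_ge_inverse f n _ Iy)].
  pose proof (deriv01_iter_inverse f n _ Ix) as E.
  apply (f_equal Rabs) in E. rewrite Rabs_mult, Rabs_R1 in E.
  destruct (HK n _ Ox) as [A _]. apply (le_INR 1 n) in Hn. simpl (INR 1) in Hn.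
  set (d := Rabs (deriv01 (Nat.iter n f) (1 / 2))) in *.
  set (d' := Rabs (deriv01 (Nat.iter n (dinv f)) _)) in *. set (p := displacement f (1 / 2)) in *.
  assert (Pd' : 0 <= d') by apply Rabs_pos.
  (* Distortion gives phi(1/2) |(f^n)'(1/2)| <= K phi(x_n) <= K / n; multiplying by [d'] then
     removes [d], since d d' = 1. *)
  assert (A' : p * d * INR n <= K).
  { apply Rle_trans with (K * (1 / INR n) * INR n).
    - apply Rmult_le_compat_r; [lra|]. eapply Rle_trans; [exact A|].
      apply Rmult_le_compat_l; lra.
    - apply Req_le. field. lra. }
  apply (Rmult_le_reg_r K); [exact PK|].
  replace (p / K * INR n * K) with (d' * (p * d * INR n)).
  2: { replace (d' * (p * d * INR n)) with (p * INR n * (d * d')) by ring.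
       rewrite E. field. lra. }
  apply Rmult_le_compat_l; assumption.
Qed.

(** * Passage to logarithms *)

(** Needed before taking the logarithm of the upper bound; the derivative 1 of all iterates at the
    flat fixed point 0 supplies it. *)
Lemma growth_pos (f : Diff01) (n : nat) : flat_fixed_points f 0 -> 0 < growth f n.
Proof.
  intros [[I0 F0] [D0 _]].
  pose proof (deriv01_iter_inverse f n 0 I0) as E.
  assert (Fn : forall k, Nat.iter k f 0 = 0).
  { induction k as [|k IH]; [reflexivity|]. simpl. rewrite IH. exact F0. }
  rewrite (deriv01_iter_fixed f n 0 I0 F0 D0), Fn, Rmult_1_l in E.
  eapply Rlt_le_trans; [|exact (growth_ge_inverse f n 0 I0)].
  rewrite E, Rabs_R1. lra.
Qed.

Theorem theorem3 (f : Diff01)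
  (f_not_id : ~ (forall x : R, I01 x -> f x = x))
  (E_f : forall x : R, fixed_points f x <-> (x = 0 \/ x = 1))
  (Einfty_f : forall x : R, flat_fixed_points f x <-> (x = 0 \/ x = 1))
  (phi_pos : forall x : R, 0 < x < 1 -> 0 < displacement f x)
  (phi_reg : forall eps : R, 0 < eps ->
     exists C : R, 0 < C /\
       (forall x y : R, 0 < y -> y < x -> x < 1 / 2 ->
          displacement f y <= C * Rpower (displacement f x) (1 - eps)) /\
       (forall x y : R, 1 / 2 < x -> x < y -> y < 1 ->
          displacement f y <= C * Rpower (displacement f x) (1 - eps))) :
  LimSup_seq (fun n : nat => ln (growth f n) / ln (INR n)) = Finite 1.
Proof.
  assert (F0 : flat_fixed_points f 0) by (apply Einfty_f; left; reflexivity).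
  assert (F1 : flat_fixed_points f 1) by (apply Einfty_f; right; reflexivity).
  apply is_LimSup_seq_unique. intros [eps Peps]. simpl. split.
  - intros N. destruct (growth_linear_often f phi_pos) as [c [Pc Hc]].
    (* Beyond this threshold eps ln n > - ln c, so ln c + ln n > (1 - eps) ln n. *)
    destruct (ln_INR_unbounded (Rabs (ln c / eps))) as [N' [_ HN']].
    destruct (Hc (N + N')%nat) as [n [Hn L]]. exists n. split; [lia|].
    specialize (HN' n ltac:(lia)).
    assert (Pl : 0 < ln (INR n)) by (eapply Rle_lt_trans; [apply Rabs_pos | exact HN']).
    assert (Pn : 0 < INR n).
    (* [ln 0] has the default value 0, so [0 < ln (INR n)] excludes n = 0. *)
    { apply lt_0_INR. destruct n; [|lia]. exfalso. clear - Pl. simpl in Pl.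
      unfold ln in Pl. destruct (Rlt_dec 0 0); lra. }
    apply (Rmult_lt_reg_r (ln (INR n))); [exact Pl|].
    unfold Rdiv. rewrite Rmult_assoc, Rinv_l, Rmult_1_r by lra.
    apply ln_le in L; [|apply Rmult_lt_0_compat; assumption].
    rewrite ln_mult in L by assumption.
    assert (Hl : - (ln c / eps) < ln (INR n)).
    { eapply Rle_lt_trans; [|exact HN']. rewrite <- Rabs_Ropp. apply Rle_abs. }
    apply (Rmult_lt_compat_l eps) in Hl; [|exact Peps].
    replace (eps * - (ln c / eps)) with (- ln c) in Hl by (field; lra). lra.
  (* With this [s] the exponent 1 / s is 1 + eps / 2, and the other eps / 2 absorbs [ln K] once n is
     large. *)
  - set (s := 1 / (1 + eps / 2)).
    assert (Hs : 0 < s < 1).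
    { unfold s. split; [apply Rdiv_lt_0_compat; lra|].
      apply (Rmult_lt_reg_r (1 + eps / 2)); [lra|].
      unfold Rdiv at 1. rewrite Rmult_assoc, Rinv_l; lra. }
    destruct (growth_polynomial_bound f s F0 F1 phi_pos (proj1 Hs)
      (displacement_deriv_bound f s F0 F1 phi_pos phi_reg Hs)) as [K [PK HK]].
    replace (1 / s) with (1 + eps / 2) in HK by (unfold s; field; lra).
    destruct (ln_INR_unbounded (Rabs (ln K / (eps / 2)))) as [N [HN2 HN]].
    exists N. intros n Hn. specialize (HN n Hn). specialize (HK n ltac:(lia)).
    assert (Pl : 0 < ln (INR n)) by (eapply Rle_lt_trans; [apply Rabs_pos | exact HN]).
    apply ln_le in HK; [|exact (growth_pos f n F0)].
    rewrite ln_mult in HK by (trivial; apply exp_pos).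
    unfold Rpower in HK. rewrite ln_exp in HK.
    apply (Rmult_lt_reg_r (ln (INR n))); [exact Pl|].
    unfold Rdiv. rewrite Rmult_assoc, Rinv_l, Rmult_1_r by lra.
    assert (Hl : ln K / (eps / 2) < ln (INR n))
      by (eapply Rle_lt_trans; [apply Rle_abs | exact HN]).
    apply (Rmult_lt_compat_l (eps / 2)) in Hl; [|lra].
    replace (eps / 2 * (ln K / (eps / 2))) with (ln K) in Hl by (field; lra). lra.
Qed.
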